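(* Let $\theta:(0,1)\times(-1,1)\to(0,\pi)$ be the fractional contact angle function, i.e. for $s\in(0,1)$ and $\sigma\in(-1,1)$, $\theta(s,\sigma)\in(0,\pi)$ is defined implicitly by $$1+\sigma=(\sin\theta)^s\,\frac{M(\theta,s)}{M\left(\frac{\pi}{2},s\right)},\qquad M(\theta,s)=2\int_0^{\theta}\left[\int_0^{+\infty}\frac{r\,dr}{(r^2+2r\cos t+1)^{\frac{2+s}{2}}}\right]dt .$$ Then, for every $s\in(0,1)$, the function $\theta(s,\cdot)$ is strictly increasing on $(-1,1)$. Moreover, for every $\sigma\in(-1,1)$, $$\theta(s,\sigma)=\arccos(-\sigma)-\frac{2\sigma\log 2+(1-\sigma)\log(1-\sigma)-(1+\sigma)\log(1+\sigma)}{2\sqrt{1-\sigma^2}}\,(1-s)+o(1-s)\qquad\text{as } s\to1^-,$$ and $$\theta(s,\sigma)=\frac{\pi}{2}(1+\sigma)-\left[\frac{\pi}{2}(1+\sigma)\log\left(\cos\frac{\pi\sigma}{2}\right)-\Xi\left(\frac{\pi}{2}(1+\sigma)\right)+(1+\sigma)\,\Xi\left(\frac{\pi}{2}\right)\right]s+o(s)\qquad\text{as } s\to0^+,$$ where $\Xi(\alpha):=\int_0^{\alpha}\frac{t}{\tan t}\,dt$.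
   Context: The equation in the claim is known to determine, for each $(s,\sigma)\in(0,1)\times(-1,1)$, a unique angle $\theta(s,\sigma)\in(0,\pi)$, and $\theta\in C^\infty((0,1)\times(-1,1);(0,\pi))$. This $\theta(s,\sigma)$ is the angle prescribed by the fractional Young's law $\nu_E(x)\cdot\nu_\Omega(x)=\cos(\pi-\theta(s,\sigma))$ at points $x\in\partial\Omega\cap\overline{\Omega\cap\partial E}$, for sufficiently regular volume-constrained critical points $E\subset\Omega$ of the energy $I_s(E,E^c\cap\Omega)+\sigma I_s(E,\Omega^c)+\int_E g$, where $I_s(A,B)=\int_A dx\int_B\frac{dy}{|x-y|^{n+s}}$ and $\nu_E,\nu_\Omega$ are outer unit normals. In the definition of $\Xi$, the integrand $t/\tan t$ is extended by continuity: value $1$ at $t=0$ and value $0$ at $t=\pi/2$; $\Xi$ is only evaluated at arguments in $(0,\pi)$. Here $\log$ is the natural logarithm, and the terms $o(1-s)$, $o(s)$ are for fixed $\sigma$. *)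

(* Defs.v *)
From Stdlib Require Import Reals.
From Coquelicot Require Import Coquelicot.
Open Scope R_scope.

Definition M (theta s : R) : R :=
  2 * RInt (fun t : R =>
        RInt_gen (fun r : R =>
            r / Rpower (r ^ 2 + 2 * r * cos t + 1) ((2 + s) / 2))
          (at_point 0) (Rbar_locally p_infty))
      0 theta.

(* The values of [theta] outside (0,1) x (-1,1) are unconstrained. *)
Definition is_fractional_contact_angle (theta : R -> R -> R) : Prop :=
  forall s sigma : R, 0 < s < 1 -> -1 < sigma < 1 ->
    0 < theta s sigma < PI /\
    1 + sigma =
      Rpower (sin (theta s sigma)) s * (M (theta s sigma) s / M (PI / 2) s).

(* t / tan t extended by continuity; [tan] and [/] are total, so the values
   at 0 and PI / 2 have to be given separately. *)
Definition t_over_tan (t : R) : R :=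
  if Req_EM_T t 0 then 1
  else if Req_EM_T t (PI / 2) then 0
  else t / tan t.

Definition Xi (alpha : R) : R := RInt t_over_tan 0 alpha.

(* Main.v *)
Require Import Defs.
From Stdlib Require Import Reals Lra.
From Coquelicot Require Import Coquelicot.
Open Scope R_scope.

(** The theorem rests on a closed form for the double integral [M]. Write
    S(s, x) for the integral of [sin ^ s] over [0, x]. The substitution
    [r + cos t = sin t * cotan phi] turns the inner integral into
    [sin t ^ (-1-s)] times the integral of [sin (t - phi) * sin phi ^ (s-1)]
    over [0 < phi < t], hence into
    [1 / s - cos t * S(s, t) / sin t ^ (1+s)] ([inner_integral]). That is the
    derivative of [S(s, t) / (s * sin t ^ s)], so that
    [sin x ^ s * M x s = 2 * S(s, x) / s] ([M_eq]) and the equation for the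
    angle becomes, since [sin (PI/2) = 1],
    [S(s, theta) = (1 + sigma) * S(s, PI/2)] ([contact_angle_eq]).

    Strict monotonicity in [sigma] follows because S is strictly increasing in
    its second argument.

    For the asymptotics, S is expanded in [s] at a fixed angle, with a quadratic
    error. At [s = 1] the first-order coefficient is the integral of
    [sin * ln sin], which is elementary ([sin_power_integral_expansion_1]). At
    [s = 0] it is the integral of [ln sin], and an integration by parts turns
    it into [x * ln (sin x) - Xi x] ([sin_power_integral_expansion_0]). The
    expansions at the limit angle and at [PI/2] measure by how much the limit
    angle fails the equation for a nearby [s]; dividing that defect by
    [sin ^ s] at an intermediate angle gives the displacement of theta
    ([implicit_angle_expansion]). *)

(** * Calculus on intervals *)

Lemma mvt_interior (f df : R -> R) (a b : R) :
  a < b ->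
  (forall x, a < x < b -> is_derive f x (df x)) ->
  (forall x, a <= x <= b -> continuous f x) ->
  exists c, a < c < b /\ f b - f a = df c * (b - a).
Proof.
  intros Hab Hd Hc.
  assert (pr1 : forall c, a < c < b -> derivable_pt f c).
  { intros c H; exists (df c); apply is_derive_Reals, Hd, H. }
  assert (pr2 : forall c, a < c < b -> derivable_pt id c).
  { intros c _; apply derivable_pt_id. }
  destruct (MVT f id a b pr1 pr2 Hab) as [c [P E]].
  - intros c H; apply continuity_pt_filterlim, Hc, H.
  - intros c _; apply derivable_continuous_pt, derivable_pt_id.
  - exists c; split; [exact P|].
    assert (E1 : derive_pt f c (pr1 c P) = df c).
    { apply derive_pt_eq_0, is_derive_Reals, Hd, P. }
    assert (E2 : derive_pt id c (pr2 c P) = 1).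
    { apply derive_pt_eq_0, derivable_pt_lim_id. }
    rewrite E1, E2 in E; unfold id in E; lra.
Qed.

Lemma le_of_derive_ge0 (f df : R -> R) (a b : R) :
  a <= b ->
  (forall x, a < x < b -> is_derive f x (df x)) ->
  (forall x, a <= x <= b -> continuous f x) ->
  (forall x, a < x < b -> 0 <= df x) ->
  f a <= f b.
Proof.
  intros [Hab| ->] Hd Hc Hp; [|lra].
  destruct (mvt_interior f df a b Hab Hd Hc) as [c [Hc1 E]].
  specialize (Hp c Hc1); nra.
Qed.

Lemma is_derive_RInt_interval (f : R -> R) (A B a x : R) :
  (forall z, A < z < B -> continuous f z) -> A < a < B -> A < x < B ->
  is_derive (fun y => RInt f a y) x (f x).
Proof.
  intros Hf Ha Hx; apply is_derive_RInt with a; [|now apply Hf].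
  assert (HA : locally x (fun y => A < y)) by now apply open_gt.
  assert (HB : locally x (fun y => y < B)) by now apply open_lt.
  generalize (filter_and _ _ HA HB); apply filter_imp.
  intros y Hy; apply RInt_correct, ex_RInt_continuous.
  intros z Hz; apply Hf; split.
  - apply Rlt_le_trans with (2 := proj1 Hz); now apply Rmin_glb_lt.
  - apply Rle_lt_trans with (1 := proj2 Hz); now apply Rmax_lub_lt.
Qed.

(** The antiderivative is only required to be differentiable in the open
    interval: at a boundary point where it is merely continuous, a mean value
    argument replaces the usual formula. *)
Lemma RInt_antiderivative (f F : R -> R) (A B a b : R) :
  A < a -> a <= b -> b < B ->
  (forall z, A < z < B -> continuous f z) ->
  (forall x, a < x < b -> is_derive F x (f x)) ->
  (forall x, a <= x <= b -> continuous F x) ->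
  RInt f a b = F b - F a.
Proof.
  intros HA Hab HB Hf HF HFc.
  assert (Hd : forall x, A < x < B -> is_derive (fun y => RInt f a y) x (f x)).
  { intros x Hx; apply is_derive_RInt_interval with A B; auto; lra. }
  assert (Hc : forall x, a <= x <= b -> continuous (fun y => RInt f a y) x).
  { intros x Hx; apply (ex_derive_continuous (fun y => RInt f a y)).
    exists (f x); apply Hd; lra. }
  assert (H1 : RInt f a a - F a <= RInt f a b - F b).
  { apply (le_of_derive_ge0 (fun x => RInt f a x - F x) (fun _ => 0) a b Hab).
    - intros x Hx; replace 0 with (minus (f x) (f x)) by (unfold minus, plus, opp; simpl; ring).
      apply (is_derive_minus (fun y => RInt f a y) F); [apply Hd; lra|now apply HF].
    - intros x Hx; apply (continuous_minus (fun y => RInt f a y) F); auto.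
    - intros; lra. }
  assert (H2 : F a - RInt f a a <= F b - RInt f a b).
  { apply (le_of_derive_ge0 (fun x => F x - RInt f a x) (fun _ => 0) a b Hab).
    - intros x Hx; replace 0 with (minus (f x) (f x)) by (unfold minus, plus, opp; simpl; ring).
      apply (is_derive_minus F (fun y => RInt f a y)); [now apply HF|apply Hd; lra].
    - intros x Hx; apply (continuous_minus F (fun y => RInt f a y)); auto.
    - intros; lra. }
  rewrite RInt_point in H1, H2; change (@zero _) with 0 in *; lra.
Qed.

Lemma Rabs_le_of_derive (f g df dg : R -> R) (a b : R) :
  a <= b ->
  (forall x, a < x < b -> is_derive f x (df x)) ->
  (forall x, a < x < b -> is_derive g x (dg x)) ->
  (forall x, a <= x <= b -> continuous f x) ->
  (forall x, a <= x <= b -> continuous g x) ->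
  (forall x, a < x < b -> Rabs (df x) <= dg x) ->
  Rabs (f b - f a) <= g b - g a.
Proof.
  intros Hab Hf Hg Hcf Hcg Hle.
  assert (H1 : g a - f a <= g b - f b).
  { apply (le_of_derive_ge0 (fun x => g x - f x) (fun x => dg x - df x) a b Hab).
    - intros x Hx; apply (is_derive_minus g f); auto.
    - intros x Hx; apply (continuous_minus g f); auto.
    - intros x Hx; generalize (Rle_abs (df x)) (Hle x Hx); lra. }
  assert (H2 : g a + f a <= g b + f b).
  { apply (le_of_derive_ge0 (fun x => g x + f x) (fun x => dg x + df x) a b Hab).
    - intros x Hx; apply (is_derive_plus g f); auto.
    - intros x Hx; apply (continuous_plus g f); auto.
    - intros x Hx; generalize (Rcomplements.Rabs_maj2 (df x)) (Hle x Hx); lra. }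
  apply Rabs_le; lra.
Qed.

(** Gluing at a boundary point, the device by which the integrands below
    acquire values, and two-sided continuity, at the origin. *)
Lemma continuous_squeeze_right (f g : R -> R) (a l : R) :
  (forall x, x <= a -> f x = l) ->
  locally a (fun x => a < x -> Rabs (f x - l) <= g x) ->
  filterlim g (at_right a) (locally 0) ->
  continuous f a.
Proof.
  intros Hl Hr Hg; unfold continuous; rewrite (Hl a (Rle_refl a)).
  apply filterlim_locally; intros eps.
  assert (Hg' := proj1 (filterlim_locally _ _) Hg eps).
  unfold at_right, within in Hg'.
  generalize (filter_and _ _ Hr Hg'); apply filter_imp.
  intros x [H1 H2].
  change (Rabs (f x - l) < eps).
  destruct (Rle_lt_dec x a) as [Hx|Hx].
  - rewrite (Hl x Hx), Rminus_eq_0, Rabs_R0; apply cond_pos.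
  - specialize (H1 Hx); specialize (H2 Hx).
    change (Rabs (g x - 0) < eps) in H2; rewrite Rminus_0_r in H2.
    apply Rle_lt_trans with (1 := H1), Rle_lt_trans with (2 := H2), Rle_abs.
Qed.

Lemma continuous_at_right (g : R -> R) (a l : R) :
  g a = l -> continuous g a -> filterlim g (at_right a) (locally l).
Proof.
  intros <- Hg; apply filterlim_filter_le_1 with (2 := Hg).
  apply filter_le_within.
Qed.

Lemma continuous_Rpower {U : UniformSpace} (f g : U -> R) (x : U) :
  0 < f x -> continuous f x -> continuous g x ->
  continuous (fun y => Rpower (f y) (g y)) x.
Proof.
  intros Hp Hf Hg; unfold Rpower.
  apply (continuous_comp (fun y => g y * ln (f y)) exp).
  - apply (continuous_mult g (fun y => ln (f y))); [exact Hg|].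
    apply (continuous_comp f ln); [exact Hf|].
    apply (ex_derive_continuous ln); auto_derive; lra.
  - apply (ex_derive_continuous exp); auto_derive; exact I.
Qed.

Lemma Rpower_pos (x y : R) : 0 < Rpower x y.
Proof. apply exp_pos. Qed.

(** * The integral of a power of the sine *)

(** The value 0 on the negative axis makes the function continuous at the
    origin, where [Rpower (sin 0) s] is 1. *)
Definition sin_power (s t : R) : R :=
  if Rle_dec t 0 then 0 else Rpower (sin t) s.

Definition sin_power_integral (s x : R) : R := RInt (sin_power s) 0 x.

Lemma sin_power_pos_arg (s t : R) : 0 < t -> sin_power s t = Rpower (sin t) s.
Proof. intros H; unfold sin_power; destruct Rle_dec; [lra|reflexivity]. Qed.

Lemma sin_power_neg_arg (s t : R) : t <= 0 -> sin_power s t = 0.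
Proof. intros H; unfold sin_power; destruct Rle_dec; [reflexivity|lra]. Qed.

Lemma sin_le_id (t : R) : 0 <= t -> sin t <= t.
Proof. intros [H| <-]; [left; now apply sin_lt_x|rewrite sin_0; lra]. Qed.

Lemma Rpower_lim_0 (s : R) : 0 < s ->
  filterlim (fun t => Rpower t s) (at_right 0) (locally 0).
Proof.
  intros Hs; apply filterlim_locally; intros eps.
  exists (mkposreal _ (Rpower_pos eps (/ s))); intros t Ht Hpos.
  change (Rabs (t - 0) < Rpower eps (/ s)) in Ht.
  change (Rabs (Rpower t s - 0) < eps).
  rewrite Rminus_0_r, Rabs_pos_eq in Ht by lra.
  rewrite Rminus_0_r, Rabs_pos_eq by (left; apply Rpower_pos).
  apply Rlt_le_trans with (Rpower (Rpower eps (/ s)) s).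
  - apply Rlt_Rpower_l; lra.
  - rewrite Rpower_mult, Rinv_l, Rpower_1 by (apply cond_pos || lra); lra.
Qed.

Lemma sin_power_continuous (s t : R) : 0 < s -> t < PI ->
  continuous (sin_power s) t.
Proof.
  intros Hs Ht; destruct (Rtotal_order t 0) as [H|[->|H]].
  - apply continuous_ext_loc with (fun _ => 0).
    + apply filter_imp with (fun y => y < 0); [|now apply open_lt].
      intros y Hy; symmetry; apply sin_power_neg_arg; lra.
    + apply continuous_const.
  - apply continuous_squeeze_right with (fun t => Rpower t s) 0.
    + intros x Hx; now apply sin_power_neg_arg.
    + apply filter_imp with (fun y => y < PI); [|apply open_lt, PI_RGT_0].
      intros x Hx Hx0; rewrite sin_power_pos_arg, Rminus_0_r by assumption.
      rewrite Rabs_pos_eq by (left; apply Rpower_pos).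
      apply Rle_Rpower_l; [lra|split; [now apply sin_gt_0|apply sin_le_id; lra]].
    + now apply Rpower_lim_0.
  - apply continuous_ext_loc with (fun t => Rpower (sin t) s).
    + apply filter_imp with (fun y => 0 < y); [|now apply open_gt].
      intros y Hy; symmetry; now apply sin_power_pos_arg.
    + apply (continuous_Rpower sin (fun _ => s)).
      * now apply sin_gt_0.
      * apply continuous_sin.
      * apply continuous_const.
Qed.

Lemma sin_power_integral_derive (s x : R) : 0 < s -> x < PI ->
  is_derive (sin_power_integral s) x (sin_power s x).
Proof.
  intros Hs Hx; assert (HP := PI_RGT_0); assert (Hm := Rmin_l 0 x).
  assert (Hm' := Rmin_r 0 x).
  apply is_derive_RInt_interval with (Rmin 0 x - 1) PI; try lra.
  intros z Hz; apply sin_power_continuous; lra.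
Qed.

Lemma sin_power_integral_continuous (s x : R) : 0 < s -> x < PI ->
  continuous (sin_power_integral s) x.
Proof.
  intros Hs Hx; apply (ex_derive_continuous (sin_power_integral s)).
  eexists; now apply sin_power_integral_derive.
Qed.

Lemma sin_power_integral_0 (s : R) : sin_power_integral s 0 = 0.
Proof. apply (@RInt_point R_CompleteNormedModule). Qed.

Lemma sin_power_integral_mvt (s a b : R) : 0 < s -> 0 <= a -> a < b -> b < PI ->
  exists c, a < c < b /\
    sin_power_integral s b - sin_power_integral s a = Rpower (sin c) s * (b - a).
Proof.
  intros Hs Ha Hab Hb.
  destruct (mvt_interior (sin_power_integral s) (sin_power s) a b Hab)
    as [c [Hc E]].
  - intros x Hx; apply sin_power_integral_derive; lra.
  - intros x Hx; apply sin_power_integral_continuous; lra.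
  - exists c; split; [exact Hc|]; rewrite E, sin_power_pos_arg; lra.
Qed.

Lemma sin_power_integral_lt (s a b : R) : 0 < s -> 0 <= a -> a < b -> b < PI ->
  sin_power_integral s a < sin_power_integral s b.
Proof.
  intros Hs Ha Hab Hb.
  destruct (sin_power_integral_mvt s a b Hs Ha Hab Hb) as [c [_ E]].
  generalize (Rpower_pos (sin c) s); nra.
Qed.

Lemma sin_power_integral_pos (s x : R) : 0 < s -> 0 < x < PI ->
  0 < sin_power_integral s x.
Proof.
  intros Hs Hx; rewrite <- (sin_power_integral_0 s).
  apply sin_power_integral_lt; lra.
Qed.

(** * Evaluation of the double integral *)

Lemma sin_power_derive (s x : R) : 0 < x < PI ->
  is_derive (sin_power s) x (s * cos x / sin x * sin_power s x).
Proof.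
  intros Hx; assert (Hp := sin_gt_0 x (proj1 Hx) (proj2 Hx)).
  apply is_derive_ext_loc with (fun t => Rpower (sin t) s).
  - apply filter_imp with (fun y => 0 < y); [|now apply open_gt].
    intros y Hy; symmetry; now apply sin_power_pos_arg.
  - rewrite sin_power_pos_arg by lra; unfold Rpower.
    auto_derive; [lra|field; lra].
Qed.

Lemma sin_mul_power_derive (s x : R) : 0 < x < PI ->
  is_derive (fun y => sin y * sin_power s y) x
    ((1 + s) * cos x * sin_power s x).
Proof.
  intros Hx; assert (Hp := sin_gt_0 x (proj1 Hx) (proj2 Hx)).
  assert (Hd := sin_power_derive s x Hx).
  auto_derive.
  - eexists; exact Hd.
  - change (fun x0 => sin_power s x0) with (sin_power s).
    rewrite (is_derive_unique _ _ _ Hd); field; lra.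
Qed.

Lemma sin_mul_power_continuous (s x : R) : 0 < s -> x < PI ->
  continuous (fun y => sin y * sin_power s y) x.
Proof.
  intros Hs Hx; apply (continuous_mult sin (sin_power s)).
  - apply continuous_sin.
  - now apply sin_power_continuous.
Qed.

(** Together with [cos_mul_sin_power_integral_le], this pins the behaviour of
    the integral at the origin: on [(0, t)], with [t < PI / 2], the density [sin ^ s] lies between
    [sin ^ s * cos] and [sin ^ s * cos / cos t], and [sin ^ s * cos] is the
    derivative of [sin ^ (1+s) / (1+s)]. *)
Lemma sin_power_integral_ge (s t : R) : 0 < s -> 0 < t < PI ->
  sin t * sin_power s t <= (1 + s) * sin_power_integral s t.
Proof.
  intros Hs Ht.
  assert (H : (1 + s) * sin_power_integral s 0 - sin 0 * sin_power s 0
    <= (1 + s) * sin_power_integral s t - sin t * sin_power s t).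
  { apply (le_of_derive_ge0
      (fun x => (1 + s) * sin_power_integral s x - sin x * sin_power s x)
      (fun x => (1 + s) * sin_power s x - (1 + s) * cos x * sin_power s x)).
    - lra.
    - intros x Hx.
      apply (is_derive_minus (fun x => (1 + s) * sin_power_integral s x)
        (fun x => sin x * sin_power s x)).
      + apply (is_derive_scal (sin_power_integral s)).
        apply sin_power_integral_derive; lra.
      + apply sin_mul_power_derive; lra.
    - intros x Hx.
      apply (continuous_minus (fun x => (1 + s) * sin_power_integral s x)
        (fun x => sin x * sin_power s x)).
      + apply (continuous_scal_r (1 + s) (sin_power_integral s)).
        apply sin_power_integral_continuous; lra.
      + apply sin_mul_power_continuous; lra.
    - intros x Hx; rewrite sin_power_pos_arg by lra.
      assert (H1 := Rpower_pos (sin x) s); assert (H2 := COS_bound x).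
      replace (_ - _) with ((1 + s) * Rpower (sin x) s * (1 - cos x)) by ring.
      apply Rmult_le_pos; [|lra]; apply Rmult_le_pos; lra. }
  rewrite sin_0, sin_power_integral_0 in H; lra.
Qed.

Lemma cos_mul_sin_power_integral_le (s t : R) : 0 < s -> 0 < t < PI ->
  (1 + s) * (cos t * sin_power_integral s t) <= sin t * sin_power s t.
Proof.
  intros Hs Ht.
  assert (H : sin 0 * sin_power s 0 - (1 + s) * (cos 0 * sin_power_integral s 0)
    <= sin t * sin_power s t - (1 + s) * (cos t * sin_power_integral s t)).
  { apply (le_of_derive_ge0
      (fun x => sin x * sin_power s x - (1 + s) * (cos x * sin_power_integral s x))
      (fun x => (1 + s) * cos x * sin_power s x
         - (1 + s) * (- sin x * sin_power_integral s x + cos x * sin_power s x))).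
    - lra.
    - intros x Hx.
      apply (is_derive_minus (fun x => sin x * sin_power s x)
        (fun x => (1 + s) * (cos x * sin_power_integral s x))).
      + apply sin_mul_power_derive; lra.
      + apply (is_derive_scal (fun x => cos x * sin_power_integral s x)).
        apply (is_derive_mult cos (sin_power_integral s)).
        * apply is_derive_cos.
        * apply sin_power_integral_derive; lra.
        * intros; apply Rmult_comm.
    - intros x Hx.
      apply (continuous_minus (fun x => sin x * sin_power s x)
        (fun x => (1 + s) * (cos x * sin_power_integral s x))).
      + apply sin_mul_power_continuous; lra.
      + apply (continuous_scal_r (1 + s) (fun x => cos x * sin_power_integral s x)).
        apply (continuous_mult cos (sin_power_integral s)).
        * apply continuous_cos.
        * apply sin_power_integral_continuous; lra.
    - intros x Hx.
      assert (H1 := sin_power_integral_pos s x Hs ltac:(lra)).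
      assert (H2 := sin_gt_0 x ltac:(lra) ltac:(lra)).
      replace (_ - _) with ((1 + s) * sin x * sin_power_integral s x) by ring.
      apply Rmult_le_pos; [|lra]; apply Rmult_le_pos; lra. }
  rewrite sin_0, sin_power_integral_0 in H; lra.
Qed.

(** The substitution [r + cos t = sin t * cotan phi] sends [r = 0] to
    [phi = t] and [r = +oo] to [phi = 0]. Using [atan] rather than a cotangent makes it smooth
    in [r] on the whole line. *)
Definition cot_angle (t r : R) : R := PI / 2 - atan ((r + cos t) / sin t).

Lemma cot_angle_bound (t r : R) : 0 < cot_angle t r < PI.
Proof. unfold cot_angle; generalize (atan_bound ((r + cos t) / sin t)); lra. Qed.

Lemma cot_angle_0 (t : R) : 0 < t < PI -> cot_angle t 0 = t.
Proof.
  intros Ht; assert (Hp := sin_gt_0 t (proj1 Ht) (proj2 Ht)).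
  unfold cot_angle; rewrite Rplus_0_l.
  replace (cos t / sin t) with (tan (PI / 2 - t)).
  - rewrite atan_tan; lra.
  - unfold tan; now rewrite sin_shift, cos_shift.
Qed.

Lemma cot_angle_lim (t : R) : 0 < t < PI ->
  filterlim (cot_angle t) (Rbar_locally p_infty) (locally 0).
Proof.
  intros Ht; assert (Hp := sin_gt_0 t (proj1 Ht) (proj2 Ht)).
  apply filterlim_ext_loc with (fun r => atan (/ ((r + cos t) / sin t))).
  - exists (- cos t); intros r Hr; unfold cot_angle; apply atan_inv.
    apply Rdiv_lt_0_compat; lra.
  - rewrite <- atan_0.
    apply (filterlim_comp _ _ _ (fun r => / ((r + cos t) / sin t)) atan _ (locally 0)).
    2:{ apply continuity_pt_filterlim, derivable_continuous_pt, derivable_pt_atan. }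
    apply filterlim_locally; intros eps.
    assert (He := cond_pos eps).
    exists (sin t / eps - cos t); intros r Hr.
    change (Rabs (/ ((r + cos t) / sin t) - 0) < eps).
    assert (H : 0 < sin t / eps) by (apply Rdiv_lt_0_compat; lra).
    rewrite Rminus_0_r, Rabs_pos_eq.
    + rewrite Rinv_div; apply Rlt_div_l; [lra|].
      apply Rmult_lt_reg_l with (/ eps); [now apply Rinv_0_lt_compat|].
      rewrite <- Rmult_assoc, Rinv_l, Rmult_1_l by lra.
      unfold Rdiv in Hr; lra.
    + left; apply Rinv_0_lt_compat, Rdiv_lt_0_compat; lra.
Qed.

Lemma cot_angle_derive (t r : R) : 0 < t < PI ->
  is_derive (cot_angle t) r (- (sin (cot_angle t r)) ^ 2 / sin t).
Proof.
  intros Ht; assert (Hp := sin_gt_0 t (proj1 Ht) (proj2 Ht)).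
  unfold cot_angle; rewrite sin_shift, cos_atan.
  assert (Hq : 0 < 1 + ((r + cos t) / sin t)²)
    by (generalize (Rle_0_sqr ((r + cos t) / sin t)); lra).
  auto_derive; [exact I|].
  rewrite Rdiv_1_l, pow_inv, pow2_sqrt by lra.
  unfold Rsqr in *; field; split; [lra|].
  apply Rgt_not_eq.
  replace (_ + _) with (sin t ^ 2 * (1 + (r + cos t) / sin t * ((r + cos t) / sin t)))
    by (field; lra).
  apply Rmult_lt_0_compat; [apply pow_lt|]; lra.
Qed.

(** The left side is the squared hypotenuse of the right triangle with legs
    [r + cos t] and [sin t], in which [phi] is opposite to [sin t]. *)
Lemma cot_angle_sin (t r : R) : 0 < t < PI ->
  r ^ 2 + 2 * r * cos t + 1 = (sin t / sin (cot_angle t r)) ^ 2.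
Proof.
  intros Ht; assert (Hp := sin_gt_0 t (proj1 Ht) (proj2 Ht)).
  assert (Hq : 0 < 1 + ((r + cos t) / sin t)²)
    by (generalize (Rle_0_sqr ((r + cos t) / sin t)); lra).
  unfold cot_angle; rewrite sin_shift, cos_atan.
  replace (sin t / (1 / sqrt (1 + ((r + cos t) / sin t)²)))
    with (sin t * sqrt (1 + ((r + cos t) / sin t)²))
    by (field; apply Rgt_not_eq, sqrt_lt_R0, Hq).
  rewrite Rpow_mult_distr, pow2_sqrt by lra.
  generalize (sin2_cos2 t); unfold Rsqr; intros E.
  replace 1 with (sin t * sin t + cos t * cos t) at 1; field; lra.
Qed.

Lemma cot_angle_cos (t r : R) : 0 < t < PI ->
  sin t * cos (cot_angle t r) = sin (cot_angle t r) * (r + cos t).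
Proof.
  intros Ht; assert (Hp := sin_gt_0 t (proj1 Ht) (proj2 Ht)).
  assert (Hq : 0 < 1 + ((r + cos t) / sin t)²)
    by (generalize (Rle_0_sqr ((r + cos t) / sin t)); lra).
  unfold cot_angle; rewrite sin_shift, cos_shift, cos_atan, sin_atan.
  field; split; [apply Rgt_not_eq, sqrt_lt_R0, Hq|lra].
Qed.

(** The primitive in [r], expressed through [phi]. It is minus the integral of
    [sin (t - psi) * sin psi ^ (s-1)] over [0 < psi < phi], expanded by the
    subtraction formula, and divided by [sin t ^ (1+s)]. *)
Definition inner_primitive (s t phi : R) : R :=
  (cos t * sin_power_integral s phi - sin t * sin_power s phi / s)
    / (sin t * sin_power s t).

Lemma inner_primitive_derive (s t r : R) : 0 < s -> 0 < t < PI ->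
  is_derive (fun r => inner_primitive s t (cot_angle t r)) r
    (r / Rpower (r ^ 2 + 2 * r * cos t + 1) ((2 + s) / 2)).
Proof.
  intros Hs Ht; assert (Hp := sin_gt_0 t (proj1 Ht) (proj2 Ht)).
  assert (Hb := cot_angle_bound t r).
  assert (Hw := sin_gt_0 _ (proj1 Hb) (proj2 Hb)).
  assert (Hphi := cot_angle_derive t r Ht).
  assert (HP := sin_power_derive s _ Hb).
  assert (HS := sin_power_integral_derive s _ Hs (proj2 Hb)).
  assert (Hc := cot_angle_cos t r Ht).
  evar_last.
  - apply (is_derive_comp (inner_primitive s t) (cot_angle t)); [|exact Hphi].
    unfold inner_primitive; auto_derive.
    + split; [eexists; exact HS|split; [eexists; exact HP|exact I]].
    + reflexivity.
  - change (fun x0 => sin_power s x0) with (sin_power s).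
    change (fun x0 => sin_power_integral s x0) with (sin_power_integral s).
    rewrite (is_derive_unique _ _ _ HP), (is_derive_unique _ _ _ HS).
    rewrite cot_angle_sin, !sin_power_pos_arg by lra.
    set (phi := cot_angle t r) in *.
    assert (Ha : 0 < sin t / sin phi) by (apply Rdiv_lt_0_compat; lra).
    rewrite <- (Rpower_pow 2 (sin t / sin phi)), Rpower_mult by exact Ha.
    replace (INR 2 * ((2 + s) / 2)) with (INR 2 + s) by (simpl; field).
    rewrite Rpower_plus, (Rpower_pow 2 (sin t / sin phi)) by exact Ha.
    assert (E : Rpower (sin t) s = Rpower (sin t / sin phi) s * Rpower (sin phi) s).
    { rewrite Rpower_mult_distr by lra; f_equal; field; lra. }
    rewrite E.
    assert (H1 := Rpower_pos (sin t / sin phi) s).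
    assert (H2 := Rpower_pos (sin phi) s).
    (* Eliminating [r] leaves a rational identity in the sines, cosines and
       powers. *)
    replace r with (sin t * cos phi / sin phi - cos t) by (rewrite Hc; field; lra).
    change scal with Rmult; simpl; field; repeat split; lra.
Qed.

Lemma inner_integral (s t : R) : 0 < s -> 0 < t < PI ->
  RInt_gen (fun r => r / Rpower (r ^ 2 + 2 * r * cos t + 1) ((2 + s) / 2))
    (at_point 0) (Rbar_locally p_infty)
  = / s - cos t * sin_power_integral s t / (sin t * sin_power s t).
Proof.
  intros Hs Ht; assert (Hp := sin_gt_0 t (proj1 Ht) (proj2 Ht)).
  assert (HP := Rpower_pos (sin t) s).
  assert (HD := fun r => inner_primitive_derive s t r Hs Ht).
  set (f := fun r => r / Rpower (r ^ 2 + 2 * r * cos t + 1) ((2 + s) / 2)) in *.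
  set (H := fun r => inner_primitive s t (cot_angle t r)) in *.
  assert (HE : forall r, Derive H r = f r) by (intros; now apply is_derive_unique).
  apply is_RInt_gen_unique.
  apply is_RInt_gen_ext with (Derive H).
  { apply filter_forall; intros ab x _; apply HE. }
  replace (/ s - _) with (0 - H 0).
  2:{ unfold H, inner_primitive; rewrite cot_angle_0, sin_power_pos_arg by lra.
      field; repeat split; lra. }
  apply is_RInt_gen_Derive.
  - apply filter_forall; intros ab x _; eexists; apply HD.
  - apply filter_forall; intros ab x _.
    apply continuous_ext with f; [intros; symmetry; apply HE|].
    assert (Hb := cot_angle_bound t x).
    assert (Hw := sin_gt_0 _ (proj1 Hb) (proj2 Hb)).
    assert (Hq : 0 < x ^ 2 + 2 * x * cos t + 1).
    { rewrite cot_angle_sin by lra; apply pow_lt, Rdiv_lt_0_compat; lra. }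
    apply (ex_derive_continuous f); unfold f, Rpower.
    auto_derive; split; [lra|split; [apply Rgt_not_eq, exp_pos|exact I]].
  - intros P HPl; apply locally_singleton in HPl; exact HPl.
  - assert (E : inner_primitive s t 0 = 0).
    { unfold inner_primitive.
      rewrite sin_power_integral_0, (sin_power_neg_arg s 0) by lra.
      unfold Rdiv; ring. }
    unfold H; rewrite <- E.
    apply (filterlim_comp _ _ _ (cot_angle t) (inner_primitive s t) _ (locally 0)).
    + now apply cot_angle_lim.
    + assert (Hpi := PI_RGT_0).
      apply (continuous_scal_l
        (fun phi => cos t * sin_power_integral s phi - sin t * sin_power s phi / s)
        (/ (sin t * sin_power s t))).
      apply (continuous_minus (fun phi => cos t * sin_power_integral s phi)
        (fun phi => sin t * sin_power s phi / s)).
      * apply (continuous_scal_r (cos t) (sin_power_integral s)).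
        now apply sin_power_integral_continuous.
      * apply (continuous_scal_l (fun phi => sin t * sin_power s phi) (/ s)).
        apply (continuous_scal_r (sin t) (sin_power s)).
        now apply sin_power_continuous.
Qed.

(** The value on the negative axis is the limit of the inner integral at
    [t = 0+], where [sin_power_integral s t] is equivalent to
    [sin t ^ (1+s) / (1+s)]. *)
Definition inner_value (s t : R) : R :=
  if Rle_dec t 0 then / s - / (1 + s)
  else / s - cos t * sin_power_integral s t / (sin t * sin_power s t).

Lemma inner_value_continuous (s t : R) : 0 < s -> t < PI ->
  continuous (inner_value s) t.
Proof.
  intros Hs Ht; destruct (Rtotal_order t 0) as [H|[->|H]].
  - apply continuous_ext_loc with (fun _ => / s - / (1 + s)).
    + apply filter_imp with (fun y => y < 0); [|now apply open_lt].
      intros y Hy; unfold inner_value; destruct Rle_dec; [reflexivity|lra].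
    + apply continuous_const.
  - apply continuous_squeeze_right with (fun t => 1 - cos t) (/ s - / (1 + s)).
    + intros x Hx; unfold inner_value; destruct Rle_dec; [reflexivity|lra].
    + assert (HP := PI2_RGT_0).
      apply filter_imp with (fun y => y < PI / 2); [|now apply open_lt].
      intros x Hx Hx0; unfold inner_value; destruct Rle_dec; [lra|].
      assert (H1 := sin_power_integral_ge s x Hs ltac:(lra)).
      assert (H2 := cos_mul_sin_power_integral_le s x Hs ltac:(lra)).
      assert (H3 := sin_gt_0 x Hx0 ltac:(lra)).
      assert (H4 := cos_gt_0 x ltac:(lra) Hx).
      assert (H5 := Rpower_pos (sin x) s).
      rewrite sin_power_pos_arg in * by lra.
      set (A := sin x * Rpower (sin x) s) in *.
      assert (H6 : 0 < A) by (apply Rmult_lt_0_compat; lra).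
      replace (_ - _) with
        ((A - (1 + s) * (cos x * sin_power_integral s x)) / ((1 + s) * A))
        by (field; lra).
      rewrite Rabs_pos_eq.
      2:{ apply Rdiv_le_0_compat; [lra|apply Rmult_lt_0_compat; lra]. }
      apply Rle_div_l; [apply Rmult_lt_0_compat; lra|].
      assert (H7 := COS_bound x).
      assert (H8 : 0 <= (1 - cos x) * (s * A)).
      { apply Rmult_le_pos; [lra|]; apply Rmult_le_pos; lra. }
      assert (H9 : cos x * A <= cos x * ((1 + s) * sin_power_integral s x)).
      { apply Rmult_le_compat_l; lra. }
      lra.
    + apply continuous_at_right; [rewrite cos_0; ring|].
      apply (continuous_minus (fun _ => 1) cos);
        [apply continuous_const|apply continuous_cos].
  - assert (Hp := sin_gt_0 t H Ht); assert (HP := Rpower_pos (sin t) s).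
    apply continuous_ext_loc with (fun t =>
      / s - cos t * sin_power_integral s t / (sin t * sin_power s t)).
    + apply filter_imp with (fun y => 0 < y); [|now apply open_gt].
      intros y Hy; unfold inner_value; destruct Rle_dec; [lra|reflexivity].
    + apply (continuous_minus (fun _ => / s)); [apply continuous_const|].
      apply (ex_derive_continuous
        (fun t => cos t * sin_power_integral s t / (sin t * sin_power s t))).
      auto_derive.
      split; [eexists; now apply sin_power_integral_derive|].
      split; [eexists; apply sin_power_derive; lra|].
      split; [|exact I].
      rewrite sin_power_pos_arg by exact H.
      apply Rgt_not_eq, Rmult_lt_0_compat; lra.
Qed.

(** That this is a primitive of the inner integral is what makes [M]
    elementary in terms of [sin_power_integral]: the term [1 / s] is the
    derivative of the numerator, the other one that of [sin ^ (-s)]. *)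
Definition outer_primitive (s t : R) : R :=
  if Rle_dec t 0 then 0 else sin_power_integral s t / (s * sin_power s t).

Lemma outer_primitive_derive (s t : R) : 0 < s -> 0 < t < PI ->
  is_derive (outer_primitive s) t (inner_value s t).
Proof.
  intros Hs Ht; assert (Hp := sin_gt_0 t (proj1 Ht) (proj2 Ht)).
  assert (HS := sin_power_integral_derive s t Hs (proj2 Ht)).
  assert (HP := sin_power_derive s t Ht).
  assert (H0 := Rpower_pos (sin t) s).
  unfold inner_value; destruct Rle_dec; [lra|].
  apply is_derive_ext_loc with (fun t => sin_power_integral s t / (s * sin_power s t)).
  - apply filter_imp with (fun y => 0 < y); [|now apply open_gt].
    intros y Hy; unfold outer_primitive; destruct Rle_dec; [lra|reflexivity].
  - evar_last.
    + auto_derive.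
      * split; [eexists; exact HS|split; [eexists; exact HP|split; [|exact I]]].
        rewrite sin_power_pos_arg by lra.
        apply Rgt_not_eq, Rmult_lt_0_compat; lra.
      * reflexivity.
    + change (fun x0 => sin_power s x0) with (sin_power s).
      change (fun x0 => sin_power_integral s x0) with (sin_power_integral s).
      rewrite (is_derive_unique _ _ _ HP), (is_derive_unique _ _ _ HS).
      rewrite sin_power_pos_arg by lra; field; lra.
Qed.

Lemma outer_primitive_continuous (s t : R) : 0 < s -> 0 <= t < PI ->
  continuous (outer_primitive s) t.
Proof.
  intros Hs [[H| <-] Ht].
  { apply (ex_derive_continuous (outer_primitive s)).
    eexists; apply outer_primitive_derive; lra. }
  apply continuous_squeeze_right with (fun t => sin t / (s * cos t)) 0.
  - intros x Hx; unfold outer_primitive; destruct Rle_dec; [reflexivity|lra].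
  - assert (HP := PI2_RGT_0).
    apply filter_imp with (fun y => y < PI / 2); [|now apply open_lt].
    intros x Hx Hx0; unfold outer_primitive; destruct Rle_dec; [lra|].
    assert (H1 := sin_power_integral_pos s x Hs ltac:(lra)).
    assert (H2 := cos_mul_sin_power_integral_le s x Hs ltac:(lra)).
    assert (H3 := sin_gt_0 x Hx0 ltac:(lra)).
    assert (H4 := cos_gt_0 x ltac:(lra) Hx).
    assert (H5 := Rpower_pos (sin x) s).
    rewrite sin_power_pos_arg in * by lra.
    rewrite Rminus_0_r, Rabs_pos_eq.
    2:{ left; apply Rdiv_lt_0_compat; [|apply Rmult_lt_0_compat]; lra. }
    apply Rle_div_l; [apply Rmult_lt_0_compat; lra|].
    replace (_ * _) with (sin x * Rpower (sin x) s / cos x) by (field; lra).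
    apply Rle_div_r; [lra|].
    assert (0 < cos x * sin_power_integral s x) by (apply Rmult_lt_0_compat; lra).
    nra.
  - apply continuous_at_right.
    + rewrite sin_0; unfold Rdiv; ring.
    + apply (ex_derive_continuous (fun t => sin t / (s * cos t))).
      auto_derive; rewrite cos_0; lra.
Qed.

Lemma M_eq (s t : R) : 0 < s -> 0 < t < PI ->
  M t s = 2 * (sin_power_integral s t / (s * Rpower (sin t) s)).
Proof.
  intros Hs Ht; unfold M; f_equal.
  rewrite (RInt_ext _ (inner_value s)).
  - transitivity (outer_primitive s t - outer_primitive s 0).
    + apply RInt_antiderivative with (-1) PI; try lra.
      * intros z Hz; now apply inner_value_continuous.
      * intros x Hx; apply outer_primitive_derive; lra.
      * intros x Hx; apply outer_primitive_continuous; lra.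
    + unfold outer_primitive; do 2 destruct Rle_dec; try lra.
      rewrite sin_power_pos_arg by lra; apply Rminus_0_r.
  - intros x; rewrite Rmin_left, Rmax_right by lra; intros Hx.
    rewrite inner_integral by lra.
    unfold inner_value; destruct Rle_dec; [lra|reflexivity].
Qed.

Lemma contact_angle_eq (theta : R -> R -> R) (s sigma : R) :
  is_fractional_contact_angle theta -> 0 < s < 1 -> -1 < sigma < 1 ->
  0 < theta s sigma < PI /\
  sin_power_integral s (theta s sigma)
    = (1 + sigma) * sin_power_integral s (PI / 2).
Proof.
  intros Hth Hs Hsig; destruct (Hth s sigma Hs Hsig) as [Ht E].
  split; [exact Ht|].
  assert (HP := PI2_RGT_0).
  assert (HI := sin_power_integral_pos s (PI / 2) ltac:(lra) ltac:(lra)).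
  assert (H1 := Rpower_pos (sin (theta s sigma)) s).
  rewrite E, !M_eq, sin_PI2 by lra.
  replace (Rpower 1 s) with 1 by (unfold Rpower; rewrite ln_1, Rmult_0_r, exp_0; reflexivity).
  field; lra.
Qed.

(** * Expansion of the integral near the two ends of the parameter range *)

Lemma exp_monotone (x y : R) : x <= y -> exp x <= exp y.
Proof.
  intros [H| ->]; [left; now apply exp_increasing|apply Rle_refl].
Qed.

Lemma exp_quadratic (u : R) : Rabs (exp u - 1 - u) <= u ^ 2 * (1 + exp u).
Proof.
  assert (H1 := exp_ineq1_le u); assert (H2 := exp_ineq1_le (- u)).
  assert (H3 := exp_pos u).
  assert (H4 : exp u * exp (- u) = 1) by (rewrite <- exp_plus, Rplus_opp_r; exact exp_0).
  assert (H5 : (1 - u) * exp u <= 1) by nra.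
  rewrite Rabs_pos_eq by lra.
  destruct (Rle_dec 0 u); nra.
Qed.

Lemma x_ln_x_continuous (x : R) : continuous (fun x => x * ln x) x.
Proof.
  assert (H0 : forall y : R, y <= 0 -> y * ln y = 0).
  { intros y Hy; unfold ln; destruct Rlt_dec; [exfalso; lra|apply Rmult_0_r]. }
  destruct (Rtotal_order x 0) as [H|[->|H]].
  - apply continuous_ext_loc with (fun _ => 0).
    + apply filter_imp with (fun y => y < 0); [|now apply open_lt].
      intros y Hy; symmetry; apply H0; lra.
    + apply continuous_const.
  - apply continuous_squeeze_right with (fun x => 2 * sqrt x) 0; [exact H0| |].
    + apply filter_imp with (fun y => y < 1); [|apply open_lt, Rlt_0_1].
      intros y Hy Hy0; rewrite <- Rpower_sqrt by exact Hy0; unfold Rpower.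
      assert (Hv : ln y < 0) by (rewrite <- ln_1; now apply ln_increasing).
      assert (E : y = exp (/ 2 * ln y) * exp (/ 2 * ln y)).
      { transitivity (exp (ln y)); [symmetry; now apply exp_ln|].
        rewrite <- exp_plus; f_equal; field. }
      assert (H1 := exp_ineq1_le (- (/ 2 * ln y))).
      assert (H2 := exp_pos (/ 2 * ln y)).
      assert (H3 : exp (/ 2 * ln y) * exp (- (/ 2 * ln y)) = 1)
        by (rewrite <- exp_plus, Rplus_opp_r; exact exp_0).
      rewrite Rminus_0_r, Rabs_left by nra.
      rewrite E at 1.
      set (e := exp (/ 2 * ln y)) in *.
      replace (- (e * e * ln y)) with (e * (e * - ln y)) by ring.
      rewrite (Rmult_comm 2); apply Rmult_le_compat_l; [lra|].
      apply (Rmult_le_compat_l e) in H1; lra.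
    + apply continuous_at_right; [rewrite sqrt_0; ring|].
      apply (continuous_scal_r 2 sqrt), continuous_sqrt.
  - apply (ex_derive_continuous (fun x => x * ln x)); auto_derive; lra.
Qed.

(** The primitive of [sin x * ln (sin x)] is this function of [cos x]. *)
Definition log_sine_primitive (c : R) : R :=
  ((1 - c) * ln (1 - c) - (1 + c) * ln (1 + c)) / 2 + c.

Lemma log_sine_primitive_continuous (c : R) : continuous log_sine_primitive c.
Proof.
  apply (continuous_plus
    (fun c => ((1 - c) * ln (1 - c) - (1 + c) * ln (1 + c)) / 2) (fun c => c));
    [|apply continuous_id].
  apply (continuous_scal_l
    (fun c => (1 - c) * ln (1 - c) - (1 + c) * ln (1 + c)) (/ 2)).
  apply (continuous_minus (fun c => (1 - c) * ln (1 - c))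
    (fun c => (1 + c) * ln (1 + c))).
  - apply (continuous_comp (fun c => 1 - c) (fun x => x * ln x)).
    + apply (continuous_minus (fun _ => 1) (fun c => c));
        [apply continuous_const|apply continuous_id].
    + apply x_ln_x_continuous.
  - apply (continuous_comp (fun c => 1 + c) (fun x => x * ln x)).
    + apply (continuous_plus (fun _ => 1) (fun c => c));
        [apply continuous_const|apply continuous_id].
    + apply x_ln_x_continuous.
Qed.

Lemma cos_interior (x : R) : 0 < x < PI -> -1 < cos x < 1.
Proof.
  intros Hx; rewrite <- cos_PI, <- cos_0; split; apply cos_decreasing_1; lra.
Qed.

Lemma log_sine_primitive_derive (x : R) : 0 < x < PI ->
  is_derive (fun x => log_sine_primitive (cos x)) x (sin x * ln (sin x)).
Proof.
  intros Hx; assert (Hp := sin_gt_0 x (proj1 Hx) (proj2 Hx)).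
  assert (Hc := cos_interior x Hx).
  unfold log_sine_primitive; auto_derive; [lra|].
  assert (E : ln (1 - cos x) + ln (1 + cos x) = 2 * ln (sin x)).
  { rewrite <- ln_mult by lra.
    replace ((1 - cos x) * (1 + cos x)) with (sin x * sin x).
    - rewrite ln_mult by exact Hp; ring.
    - generalize (sin2_cos2 x); unfold Rsqr; lra. }
  replace (ln (sin x)) with ((ln (1 - cos x) + ln (1 + cos x)) / 2) by lra.
  unfold Rminus; field; lra.
Qed.

(** Since [Rpower y s = y * exp ((s - 1) * ln y)], the error is of second order
    in [(s - 1) * ln y], with a factor at most [y + Rpower y s]. As [1 / 2 <= s],
    this factor is at most [2 * sqrt y], which absorbs the square of the
    logarithm uniformly down to [y = 0]. *)
Lemma Rpower_expansion_1 (y s : R) : 0 < y <= 1 -> 1 / 2 <= s <= 1 ->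
  Rabs (Rpower y s - y - (s - 1) * (y * ln y)) <= 32 * (s - 1) ^ 2.
Proof.
  intros Hy Hs; set (l := ln y).
  assert (Hl : l <= 0) by (unfold l; rewrite <- ln_1; apply ln_le; lra).
  assert (Ey : y = exp l) by (unfold l; rewrite exp_ln; lra).
  set (u := (s - 1) * l).
  assert (E : Rpower y s = y * exp u).
  { unfold Rpower; fold l; rewrite Ey at 1; rewrite <- exp_plus.
    f_equal; unfold u; ring. }
  replace (Rpower y s - y - (s - 1) * (y * l)) with (y * (exp u - 1 - u))
    by (rewrite E; unfold u; ring).
  rewrite Rabs_mult, (Rabs_pos_eq y) by lra.
  apply Rle_trans with (y * (u ^ 2 * (1 + exp u))).
  { apply Rmult_le_compat_l; [lra|apply exp_quadratic]. }
  assert (H1 : y * exp u <= exp (l / 2)).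
  { rewrite Ey, <- exp_plus; apply exp_monotone; unfold u; nra. }
  assert (H2 : y <= exp (l / 2)) by (rewrite Ey; apply exp_monotone; lra).
  (* [exp v >= v] at [v = - l / 4], squared *)
  assert (H3 : l ^ 2 * exp (l / 2) <= 16).
  { assert (H4 := exp_ineq1_le (- (l / 4))).
    assert (H5 := exp_pos (l / 4)).
    assert (H6 : exp (l / 4) * exp (- (l / 4)) = 1)
      by (rewrite <- exp_plus, Rplus_opp_r; exact exp_0).
    replace (l / 2) with (l / 4 + l / 4) by field.
    rewrite exp_plus; set (e := exp (l / 4)) in *.
    assert (H7 : e * (- (l / 4)) <= 1).
    { apply (Rmult_le_compat_l e) in H4; lra. }
    assert (H8 : 0 <= e * (- (l / 4))) by (apply Rmult_le_pos; lra).
    replace (l ^ 2 * (e * e)) with (16 * (e * - (l / 4)) ^ 2) by field.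
    nra. }
  replace (y * (u ^ 2 * (1 + exp u))) with ((s - 1) ^ 2 * (l ^ 2 * (y + y * exp u)))
    by (unfold u; ring).
  rewrite (Rmult_comm 32); apply Rmult_le_compat_l; [apply pow2_ge_0|].
  assert (H4 := pow2_ge_0 l); nra.
Qed.

Lemma sin_power_integral_expansion_1 (x s : R) : 0 < x < PI -> 1 / 2 <= s <= 1 ->
  Rabs (sin_power_integral s x - (1 - cos x)
    - (s - 1) * (log_sine_primitive (cos x) - log_sine_primitive 1))
  <= 32 * x * (s - 1) ^ 2.
Proof.
  intros Hx Hs.
  set (f := fun y => sin_power_integral s y + cos y
    - (s - 1) * log_sine_primitive (cos y)).
  assert (H : Rabs (f x - f 0) <= 32 * (s - 1) ^ 2 * x - 32 * (s - 1) ^ 2 * 0).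
  { apply (Rabs_le_of_derive f (fun y => 32 * (s - 1) ^ 2 * y)
      (fun y => Rpower (sin y) s - sin y - (s - 1) * (sin y * ln (sin y)))
      (fun _ => 32 * (s - 1) ^ 2)); unfold f.
    - lra.
    - intros y Hy.
      apply (is_derive_minus (fun y => sin_power_integral s y + cos y)
        (fun y => (s - 1) * log_sine_primitive (cos y))).
      + apply (is_derive_plus (sin_power_integral s) cos).
        * rewrite <- sin_power_pos_arg by lra.
          apply sin_power_integral_derive; lra.
        * apply is_derive_cos.
      + apply (is_derive_scal (fun y => log_sine_primitive (cos y))).
        apply log_sine_primitive_derive; lra.
    - intros y _; auto_derive; [exact I|ring].
    - intros y Hy.
      apply (continuous_minus (fun y => sin_power_integral s y + cos y)
        (fun y => (s - 1) * log_sine_primitive (cos y))).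
      + apply (continuous_plus (sin_power_integral s) cos).
        * apply sin_power_integral_continuous; lra.
        * apply continuous_cos.
      + apply (continuous_scal_r (s - 1) (fun y => log_sine_primitive (cos y))).
        apply (continuous_comp cos log_sine_primitive);
          [apply continuous_cos|apply log_sine_primitive_continuous].
    - intros y _; apply (ex_derive_continuous (fun y => 32 * (s - 1) ^ 2 * y)).
      auto_derive; exact I.
    - intros y Hy; apply Rpower_expansion_1; [|exact Hs].
      split; [apply sin_gt_0; lra|apply SIN_bound]. }
  unfold f in H; rewrite cos_0, sin_power_integral_0 in H.
  replace (sin_power_integral s x - _ - _) with
    (sin_power_integral s x + cos x - (s - 1) * log_sine_primitive (cos x)
      - (0 + 1 - (s - 1) * log_sine_primitive 1)) by ring.
  lra.
Qed.

(** The formula also covers [PI / 2], where [tan] has no meaningful value. *)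
Lemma t_over_tan_eq (t : R) : t <> 0 -> t_over_tan t = t * cos t / sin t.
Proof.
  intros Ht; unfold t_over_tan.
  destruct Req_EM_T as [H|_]; [contradiction|].
  destruct Req_EM_T as [->|_].
  - rewrite cos_PI2; unfold Rdiv; ring.
  - unfold tan, Rdiv; rewrite Rinv_mult, Rinv_inv; ring.
Qed.

Lemma t_over_tan_continuous (t : R) : - PI / 2 < t < PI ->
  continuous t_over_tan t.
Proof.
  intros Ht; destruct (Req_dec t 0) as [->|H0].
  - apply continuity_pt_filterlim, continuity_pt_filterlim'.
    replace (t_over_tan 0) with (1 * / 1)
      by (unfold t_over_tan; destruct Req_EM_T; lra).
    apply filterlim_ext_loc with (fun t => cos t * / (sin t / t)).
    + exists (mkposreal 1 Rlt_0_1); intros y _ Hy; rewrite t_over_tan_eq by exact Hy.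
      unfold Rdiv; rewrite Rinv_mult, Rinv_inv; ring.
    + assert (Hc : is_lim cos 0 1).
      { rewrite <- cos_0; apply is_lim_continuity, continuity_cos. }
      assert (Hi : is_lim (fun t => / (sin t / t)) 0 (/ 1)).
      { apply (is_lim_inv (fun t => sin t / t) 0 1 is_lim_sinc_0).
        intros E; injection E; lra. }
      exact (is_lim_mult cos _ 0 1 (/ 1) Hc Hi I).
  - apply continuous_ext_loc with (fun t => t * cos t / sin t).
    + destruct (Rlt_dec t 0) as [H|H].
      * apply filter_imp with (fun y => y < 0); [|now apply open_lt].
        intros y Hy; symmetry; apply t_over_tan_eq; lra.
      * apply filter_imp with (fun y => 0 < y); [|apply open_gt; lra].
        intros y Hy; symmetry; apply t_over_tan_eq; lra.
    + apply (ex_derive_continuous (fun t => t * cos t / sin t)); auto_derive.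
      destruct (Rlt_dec t 0) as [H|H].
      * apply Rlt_not_eq, sin_lt_0_var; lra.
      * apply Rgt_not_eq, sin_gt_0; lra.
Qed.

Lemma Xi_derive (x : R) : - PI / 2 < x < PI -> is_derive Xi x (t_over_tan x).
Proof.
  intros Hx; assert (HP := PI_RGT_0).
  apply is_derive_RInt_interval with (- PI / 2) PI; try lra.
  apply t_over_tan_continuous.
Qed.

Lemma t_over_tan_bounded (x : R) : 0 < x < PI ->
  exists K, 0 <= K /\ forall y, 0 <= y <= x -> Rabs (t_over_tan y) <= K.
Proof.
  intros Hx.
  destruct (continuity_ab_maj (fun y => Rabs (t_over_tan y)) 0 x) as [m [Hm _]].
  - lra.
  - intros c Hc; apply continuity_pt_filterlim.
    apply (continuous_comp t_over_tan Rabs).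
    + apply t_over_tan_continuous; lra.
    + apply continuous_Rabs.
  - exists (Rabs (t_over_tan m)); split; [apply Rabs_pos|exact Hm].
Qed.

Lemma id_mul_sin_power_derive (s x : R) : 0 < x < PI ->
  is_derive (fun y => y * sin_power s y) x
    (sin_power s x + s * (t_over_tan x * sin_power s x)).
Proof.
  intros Hx; assert (Hp := sin_gt_0 x (proj1 Hx) (proj2 Hx)).
  assert (HP := sin_power_derive s x Hx).
  auto_derive; [eexists; exact HP|].
  change (fun x0 => sin_power s x0) with (sin_power s).
  rewrite (is_derive_unique _ _ _ HP), t_over_tan_eq by lra; field; lra.
Qed.

Lemma id_mul_sin_power_continuous (s x : R) : 0 < s -> x < PI ->
  continuous (fun y => y * sin_power s y) x.
Proof.
  intros Hs Hx; apply (continuous_mult (fun y => y) (sin_power s)).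
  - apply continuous_id.
  - now apply sin_power_continuous.
Qed.

(** Integration by parts moves the singular logarithm into the bounded
    function [t / tan t]:
    [sin_power_integral s x = x * sin_power s x
       - s * RInt (fun t => t / tan t * sin_power s t) 0 x].
    Used a second time, the same identity shows that replacing the weight
    [sin_power s] by 1 costs only a further factor [s]. *)
Lemma sin_power_integral_expansion_0 (x : R) : 0 < x < PI ->
  exists C, forall s, 0 < s <= 1 ->
  Rabs (sin_power_integral s x - x - s * (x * ln (sin x) - Xi x)) <= C * s ^ 2.
Proof.
  intros Hx; destruct (t_over_tan_bounded x Hx) as [K [HK Hb]].
  assert (Hp := sin_gt_0 x (proj1 Hx) (proj2 Hx)).
  set (l := ln (sin x)).
  assert (Hl : l <= 0).
  { unfold l; rewrite <- ln_1; apply ln_le; [exact Hp|apply SIN_bound]. }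
  exists (K * x * (K - l) + 2 * x * l ^ 2); intros s Hs.
  assert (Hle : forall y, 0 < y < x -> 0 <= sin_power s y <= 1).
  { intros y Hy; rewrite sin_power_pos_arg by lra.
    split; [left; apply Rpower_pos|].
    assert (Hy1 := sin_gt_0 y ltac:(lra) ltac:(lra)).
    apply Rle_trans with (Rpower 1 s).
    - apply Rle_Rpower_l; [lra|]; generalize (SIN_bound y); lra.
    - unfold Rpower; rewrite ln_1, Rmult_0_r, exp_0; lra. }
  set (f := fun y => sin_power_integral s y - y * sin_power s y).
  assert (Hf : forall y, 0 < y < x ->
    is_derive f y (- (s * (t_over_tan y * sin_power s y)))).
  { intros y Hy.
    replace (- _) with (minus (sin_power s y)
      (sin_power s y + s * (t_over_tan y * sin_power s y)))
      by (unfold minus, plus, opp; simpl; ring).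
    apply (is_derive_minus (sin_power_integral s) (fun y => y * sin_power s y)).
    - apply sin_power_integral_derive; lra.
    - apply id_mul_sin_power_derive; lra. }
  assert (Hfc : forall y, 0 <= y <= x -> continuous f y).
  { intros y Hy.
    apply (continuous_minus (sin_power_integral s) (fun y => y * sin_power s y)).
    - apply sin_power_integral_continuous; lra.
    - apply id_mul_sin_power_continuous; lra. }
  assert (Hf0 : f 0 = 0) by (unfold f; rewrite sin_power_integral_0; ring).
  (* First use: [x - sin_power_integral s x] is of order [s]. *)
  assert (H1 : Rabs (f x - f 0) <= s * K * x - s * K * 0).
  { apply (Rabs_le_of_derive f (fun y => s * K * y)
      (fun y => - (s * (t_over_tan y * sin_power s y))) (fun _ => s * K)).
    - lra.
    - exact Hf.
    - intros y _; auto_derive; [exact I|ring].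
    - exact Hfc.
    - intros y _; apply (ex_derive_continuous (fun y => s * K * y)).
      auto_derive; exact I.
    - intros y Hy; destruct (Hle y Hy) as [Ha1 Ha2].
      rewrite Rabs_Ropp, !Rabs_mult, (Rabs_pos_eq s) by lra.
      rewrite (Rabs_pos_eq (sin_power s y)) by exact Ha1.
      apply Rmult_le_compat_l; [lra|].
      assert (Hby := Hb y ltac:(lra)); assert (Ha := Rabs_pos (t_over_tan y)); nra. }
  (* Second use: the error of the weight, integrated against a function bounded
     by [K], is at most [K] times the quantity just estimated. *)
  assert (H2 : Rabs ((f x + s * Xi x) - (f 0 + s * Xi 0))
    <= s * K * (x - sin_power_integral s x)
       - s * K * (0 - sin_power_integral s 0)).
  { apply (Rabs_le_of_derive (fun y => f y + s * Xi y)
      (fun y => s * K * (y - sin_power_integral s y))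
      (fun y => - (s * (t_over_tan y * sin_power s y)) + s * t_over_tan y)
      (fun y => s * K * (1 - sin_power s y))).
    - lra.
    - intros y Hy; apply (is_derive_plus f (fun y => s * Xi y)); [now apply Hf|].
      apply (is_derive_scal Xi), Xi_derive; lra.
    - intros y Hy; apply (is_derive_scal (fun y => y - sin_power_integral s y)).
      apply (is_derive_minus (fun y => y) (sin_power_integral s)).
      + apply (@is_derive_id R_AbsRing).
      + apply sin_power_integral_derive; lra.
    - intros y Hy; apply (continuous_plus f (fun y => s * Xi y)); [now apply Hfc|].
      apply (continuous_scal_r s Xi), (ex_derive_continuous Xi).
      eexists; apply Xi_derive; lra.
    - intros y Hy.
      apply (continuous_scal_r (s * K) (fun y => y - sin_power_integral s y)).
      apply (continuous_minus (fun y => y) (sin_power_integral s)).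
      + apply continuous_id.
      + apply sin_power_integral_continuous; lra.
    - intros y Hy; destruct (Hle y Hy) as [Ha1 Ha2].
      replace (_ + _) with (s * (t_over_tan y * (1 - sin_power s y))) by ring.
      rewrite !Rabs_mult, (Rabs_pos_eq s), (Rabs_pos_eq (1 - _)) by lra.
      rewrite Rmult_assoc; apply Rmult_le_compat_l; [lra|].
      apply Rmult_le_compat_r; [lra|]; apply Hb; lra. }
  assert (HX0 : Xi 0 = 0) by apply (@RInt_point R_CompleteNormedModule).
  rewrite Hf0, HX0, sin_power_integral_0 in H2; rewrite Hf0 in H1.
  unfold f in H1, H2; rewrite sin_power_pos_arg in H1, H2 by lra.
  set (V := sin_power_integral s x) in *.
  assert (H3 := exp_quadratic (s * l)); assert (H4 := exp_ineq1_le (s * l)).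
  change (exp (s * l)) with (Rpower (sin x) s) in H3, H4.
  set (p := Rpower (sin x) s) in *.
  assert (Hp1 : p <= 1).
  { unfold p, Rpower; fold l; rewrite <- exp_0; apply exp_monotone; nra. }
  assert (H5 : x - V <= s * (x * (K - l))).
  { rewrite Rminus_0_r in H1; apply Rabs_le_between in H1.
    nra. }
  assert (H6 : s * K * (x - V) <= K * x * (K - l) * s ^ 2).
  { apply (Rmult_le_compat_l (s * K)) in H5; [|nra].
    apply Rle_trans with (1 := H5); right; ring. }
  assert (H7 : (s * l) ^ 2 * (1 + p) <= 2 * l ^ 2 * s ^ 2).
  { replace (2 * l ^ 2 * s ^ 2) with ((s * l) ^ 2 * 2) by ring.
    apply Rmult_le_compat_l; [apply pow2_ge_0|lra]. }
  replace (V - x - s * (x * l - Xi x))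
    with ((V - x * p + s * Xi x) + x * (p - 1 - s * l)) by ring.
  apply Rle_trans with (1 := Rabs_triang _ _).
  rewrite Rabs_mult, (Rabs_pos_eq x) by lra.
  rewrite Rmult_0_r, Rplus_0_r, Rminus_0_r in H2.
  apply Rle_trans with (K * x * (K - l) * s ^ 2 + x * (2 * l ^ 2 * s ^ 2)).
  - apply Rplus_le_compat; [lra|apply Rmult_le_compat_l; lra].
  - right; ring.
Qed.

(** * From the integral to the angle *)

(** A lower bound on increments that is uniform in [s]: [sin <= sin ^ s] because
    [s <= 1]. It localises the angle before any expansion is available, and as
    it controls [cos] of the angle, continuity of [acos] finishes the job. *)
Lemma cos_diff_le_sin_power_integral (s a b : R) : 0 < s <= 1 ->
  0 <= a -> a <= b -> b < PI ->
  cos a - cos b <= sin_power_integral s b - sin_power_integral s a.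
Proof.
  intros Hs Ha Hab Hb.
  assert (H : sin_power_integral s a + cos a <= sin_power_integral s b + cos b).
  { apply (le_of_derive_ge0 (fun y => sin_power_integral s y + cos y)
      (fun y => Rpower (sin y) s + - sin y)).
    - exact Hab.
    - intros y Hy; apply (is_derive_plus (sin_power_integral s) cos).
      + rewrite <- sin_power_pos_arg by lra.
        apply sin_power_integral_derive; lra.
      + apply is_derive_cos.
    - intros y Hy; apply (continuous_plus (sin_power_integral s) cos).
      + apply sin_power_integral_continuous; lra.
      + apply continuous_cos.
    - intros y Hy.
      assert (Hp := sin_gt_0 y ltac:(lra) ltac:(lra)).
      assert (Hln : ln (sin y) <= 0).
      { rewrite <- ln_1; apply ln_le; [exact Hp|apply SIN_bound]. }
      assert (H : exp (ln (sin y)) <= Rpower (sin y) s).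
      { apply exp_monotone; nra. }
      rewrite exp_ln in H by exact Hp; lra. }
  lra.
Qed.

Lemma Rabs_cos_diff_le (s a b : R) : 0 < s <= 1 -> 0 < a < PI -> 0 < b < PI ->
  Rabs (cos b - cos a) <= Rabs (sin_power_integral s a - sin_power_integral s b).
Proof.
  intros Hs Ha Hb.
  assert (Hc : forall x y, 0 < x < PI -> 0 < y < PI -> x <= y ->
    0 <= cos x - cos y <= sin_power_integral s y - sin_power_integral s x).
  { intros x y Hx Hy Hxy; split.
    - assert (cos y <= cos x) by (apply cos_decr_1; lra); lra.
    - apply cos_diff_le_sin_power_integral; lra. }
  destruct (Rle_dec a b) as [H|H].
  - assert (H1 := Hc a b Ha Hb H).
    rewrite <- Rabs_Ropp, <- (Rabs_Ropp (sin_power_integral s a - _)).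
    rewrite !Rabs_pos_eq; lra.
  - assert (H1 := Hc b a Hb Ha ltac:(lra)).
    rewrite !Rabs_pos_eq; lra.
Qed.

Lemma sin_power_integral_mvt_sym (s a b : R) : 0 < s -> 0 < a < PI -> 0 < b < PI ->
  exists c, Rabs (c - a) <= Rabs (b - a) /\
    sin_power_integral s a - sin_power_integral s b = Rpower (sin c) s * (a - b).
Proof.
  intros Hs Ha Hb; destruct (Rtotal_order a b) as [H|[<-|H]].
  - destruct (sin_power_integral_mvt s a b) as [c [Hc E]]; try lra.
    exists c; split; [rewrite !Rabs_pos_eq; lra|lra].
  - exists a; split; [apply Rle_refl|ring].
  - destruct (sin_power_integral_mvt s b a) as [c [Hc E]]; try lra.
    exists c; split; [rewrite !Rabs_left1; lra|exact E].
Qed.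

Lemma continuous_acos (y : R) : -1 < y < 1 -> continuous acos y.
Proof.
  intros Hy; apply continuity_pt_filterlim, derivable_continuous_pt.
  now apply derivable_pt_acos.
Qed.

(** An implicit function theorem for [sin_power_integral s (th s) = v s] at a
    parameter [s0] that may lie on the boundary of the range, where the
    integral need not be differentiable jointly in its two arguments. An
    expansion at the single angle [th0] suffices: the defect there equals
    [th0 - th s] times the value of [sin ^ s] at an intermediate angle, and
    that value tends to [sin th0 ^ s0] once [th s] tends to [th0]. *)
Lemma implicit_angle_expansion (th v : R -> R) (s0 th0 l C : R) :
  0 < th0 < PI ->
  (forall s, 0 < s < 1 -> 0 < th s < PI /\ sin_power_integral s (th s) = v s) ->
  locally s0 (fun s => 0 < s < 1 ->
    Rabs (sin_power_integral s th0 - v s - l * (s - s0)) <= C * (s - s0) ^ 2) ->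
  forall eps : posreal, locally s0 (fun s => 0 < s < 1 ->
    Rabs (th s - (th0 - l / Rpower (sin th0) s0 * (s - s0)))
      <= eps * Rabs (s - s0)).
Proof.
  intros Hth0 Hth Hexp eps.
  assert (He := cond_pos eps).
  set (F := within (fun s => 0 < s < 1) (locally s0)).
  change (F (fun s => Rabs (sin_power_integral s th0 - v s - l * (s - s0))
    <= C * (s - s0) ^ 2)) in Hexp.
  change (F (fun s => Rabs (th s - (th0 - l / Rpower (sin th0) s0 * (s - s0)))
    <= eps * Rabs (s - s0))).
  assert (FF : Filter F) by (apply within_filter, locally_filter).
  assert (HF : F (fun s => 0 < s < 1)) by (unfold F, within; apply filter_forall; auto).
  assert (Hsmall : forall d, 0 < d -> F (fun s => Rabs (s - s0) < d)).
  { intros d Hd; exists (mkposreal d Hd); intros y Hy _; exact Hy. }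
  assert (Hlim : filterlim th F (locally th0)).
  { apply filterlim_ext_loc with (fun s => acos (cos (th s))).
    - apply filter_imp with (2 := HF); intros s Hs.
      destruct (Hth s Hs) as [H _]; apply acos_cos; lra.
    - rewrite <- (acos_cos th0) by lra.
      apply (filterlim_comp _ _ _ (fun s => cos (th s)) acos _ (locally (cos th0))).
      2: now apply continuous_acos, cos_interior.
      apply filterlim_locally; intros d; assert (Hd := cond_pos d).
      set (k := Rabs l + Rabs C + 1).
      assert (Hk : 0 < k) by (generalize (Rabs_pos l) (Rabs_pos C); unfold k; lra).
      assert (Hdk : 0 < d / k) by (apply Rdiv_lt_0_compat; lra).
      generalize (filter_and _ _ HF (filter_and _ _ Hexp
        (filter_and _ _ (Hsmall 1 Rlt_0_1) (Hsmall (d / k) Hdk)))).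
      apply filter_imp; intros s [Hs [H1 [H2 H3]]].
      destruct (Hth s Hs) as [Ht Ev]; rewrite <- Ev in H1.
      change (Rabs (cos (th s) - cos th0) < d).
      apply Rle_lt_trans with (1 := Rabs_cos_diff_le s th0 (th s) ltac:(lra) Hth0 Ht).
      set (D := sin_power_integral s th0 - sin_power_integral s (th s)) in *.
      set (h := s - s0) in *.
      assert (H4 : Rabs h * k < d).
      { apply Rlt_div_r; [exact Hk|exact H3]. }
      assert (H5 := Rabs_triang (D - l * h) (l * h)).
      replace (D - l * h + l * h) with D in H5 by ring.
      rewrite Rabs_mult in H5.
      assert (H6 : C * h ^ 2 <= Rabs C * Rabs h).
      { rewrite <- pow2_abs; assert (H7 := Rle_abs C).
        assert (H8 := Rabs_pos h); assert (H9 := Rabs_pos C).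
        apply Rle_trans with (Rabs C * Rabs h ^ 2).
        - apply Rmult_le_compat_r; [apply pow2_ge_0|exact H7].
        - apply Rmult_le_compat_l; [exact H9|nra]. }
      assert (H7 := Rabs_pos h); unfold k in H4; lra. }
  set (a := Rpower (sin th0) s0).
  assert (Ha : 0 < a) by apply Rpower_pos.
  assert (Hk1 : 0 < Rabs l + 1) by (generalize (Rabs_pos l); lra).
  assert (Hk2 : 0 < Rabs C + 1) by (generalize (Rabs_pos C); lra).
  (* [eta] keeps the intermediate value of [sin ^ s] above [a / 2] and its
     deviation from [a] below what a share [eps / 2] of the error allows. *)
  set (eta := Rmin (a / 2) (eps * a ^ 2 / (4 * (Rabs l + 1)))).
  assert (Heta : 0 < eta).
  { apply Rmin_glb_lt; [lra|].
    apply Rdiv_lt_0_compat; [|lra].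
    apply Rmult_lt_0_compat; [lra|apply pow_lt; lra]. }
  assert (Hcont : continuous (fun p : R * R => Rpower (sin (snd p)) (fst p)) (s0, th0)).
  { apply (continuous_Rpower (fun p : R * R => sin (snd p)) (fun p : R * R => fst p)).
    - apply sin_gt_0; simpl; lra.
    - apply (continuous_comp (fun p : R * R => snd p) sin);
        [apply continuous_snd|apply continuous_sin].
    - apply continuous_fst. }
  destruct (proj1 (filterlim_locally _ _) Hcont (mkposreal eta Heta)) as [d Hd].
  assert (Hd0 := cond_pos d).
  assert (Hd' : 0 < eps * a / (4 * (Rabs C + 1))).
  { apply Rdiv_lt_0_compat; [|lra]; apply Rmult_lt_0_compat; lra. }
  generalize (filter_and _ _ HF (filter_and _ _ Hexp
    (filter_and _ _ (proj1 (filterlim_locally _ _) Hlim d)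
      (filter_and _ _ (Hsmall _ Hd0) (Hsmall _ Hd'))))).
  apply filter_imp; intros s [Hs [H1 [H2 [H3 H4]]]].
  destruct (Hth s Hs) as [Ht Ev]; rewrite <- Ev in H1.
  destruct (sin_power_integral_mvt_sym s th0 (th s) ltac:(lra) Hth0 Ht) as [c [Hc E]].
  rewrite E in H1.
  change (Rabs (th s - th0) < d) in H2.
  assert (Hq : Rabs (Rpower (sin c) s - a) < eta).
  { apply (Hd (s, c)); split; [exact H3|].
    change (Rabs (c - th0) < d); lra. }
  set (q := Rpower (sin c) s) in *; set (h := s - s0) in *.
  assert (Hm1 := Rmin_l (a / 2) (eps * a ^ 2 / (4 * (Rabs l + 1)))).
  assert (Hm2 := Rmin_r (a / 2) (eps * a ^ 2 / (4 * (Rabs l + 1)))).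
  fold eta in Hm1, Hm2.
  assert (Hqa : a / 2 < q) by (apply Rabs_def2 in Hq; lra).
  apply Rmult_le_reg_l with q; [lra|].
  rewrite <- (Rabs_pos_eq q) at 1 by lra; rewrite <- Rabs_mult.
  replace (q * _) with
    (- (q * (th0 - th s) - l * h) + l * h * ((q - a) / a)) by (field; lra).
  apply Rle_trans with (1 := Rabs_triang _ _).
  rewrite Rabs_Ropp, !Rabs_mult.
  assert (Hh := Rabs_pos h).
  assert (G1 : C * h ^ 2 <= eps * a / 4 * Rabs h).
  { rewrite <- pow2_abs.
    apply Rle_trans with ((Rabs C + 1) * Rabs h * Rabs h).
    - assert (H5 := Rle_abs C); assert (H6 := pow2_ge_0 (Rabs h)); nra.
    - apply Rmult_le_compat_r; [exact Hh|].
      left; apply (Rmult_lt_compat_l (Rabs C + 1)) in H4; [|exact Hk2].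
      apply Rlt_le_trans with (1 := H4); right; field; lra. }
  assert (G2 : Rabs l * Rabs h * Rabs ((q - a) / a) <= eps * a / 4 * Rabs h).
  { unfold Rdiv at 1; rewrite Rabs_mult, (Rabs_pos_eq (/ a))
      by (left; now apply Rinv_0_lt_compat).
    replace (Rabs l * Rabs h * (Rabs (q - a) * / a))
      with (Rabs l * Rabs (q - a) / a * Rabs h) by (field; lra).
    apply Rmult_le_compat_r; [exact Hh|].
    apply Rle_div_l; [exact Ha|].
    apply Rle_trans with ((Rabs l + 1) * (eps * a ^ 2 / (4 * (Rabs l + 1)))).
    - apply Rmult_le_compat; try apply Rabs_pos; lra.
    - right; field; lra. }
  assert (G3 : a / 2 * (eps * Rabs h) <= q * (eps * Rabs h)).
  { apply Rmult_le_compat_r; [|lra]; apply Rmult_le_pos; lra. }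
  lra.
Qed.

(** * Monotonicity and asymptotics of the contact angle *)

Lemma log_sine_primitive_values :
  log_sine_primitive 0 = 0 /\ log_sine_primitive 1 = 1 - ln 2.
Proof.
  unfold log_sine_primitive; rewrite !Rminus_0_r, !Rplus_0_r, ln_1.
  replace (1 - 1) with 0 by ring; replace (1 + 1) with 2 by ring; split; field.
Qed.

Theorem theorem1p1 (theta : R -> R -> R)
    (Htheta : is_fractional_contact_angle theta) :
  (forall s : R, 0 < s < 1 ->
     forall sigma1 sigma2 : R,
       -1 < sigma1 -> sigma1 < sigma2 -> sigma2 < 1 ->
       theta s sigma1 < theta s sigma2)
  /\
  (forall sigma : R, -1 < sigma < 1 ->
     is_domin (at_left 1)
       (fun s : R => 1 - s)
       (fun s : R =>
          theta s sigma
          - (acos (- sigma)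
             - (2 * sigma * ln 2 + (1 - sigma) * ln (1 - sigma)
                - (1 + sigma) * ln (1 + sigma))
               / (2 * sqrt (1 - sigma ^ 2))
               * (1 - s))))
  /\
  (forall sigma : R, -1 < sigma < 1 ->
     is_domin (at_right 0)
       (fun s : R => s)
       (fun s : R =>
          theta s sigma
          - (PI / 2 * (1 + sigma)
             - (PI / 2 * (1 + sigma) * ln (cos (PI * sigma / 2))
                - Xi (PI / 2 * (1 + sigma))
                + (1 + sigma) * Xi (PI / 2))
               * s))).
Proof.
  assert (HP := PI2_RGT_0); assert (HPI := PI_RGT_0).
  assert (Hang := fun s sigma => contact_angle_eq theta s sigma Htheta).
  split; [|split].
  - intros s Hs sigma1 sigma2 H1 H12 H2.
    destruct (Hang s sigma1 Hs ltac:(lra)) as [B1 E1].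
    destruct (Hang s sigma2 Hs ltac:(lra)) as [B2 E2].
    assert (Hpos := sin_power_integral_pos s (PI / 2) ltac:(lra) ltac:(lra)).
    apply Rnot_le_lt; intros Hle.
    assert (Hge : sin_power_integral s (theta s sigma2)
      <= sin_power_integral s (theta s sigma1)).
    { destruct Hle as [Hlt|Heq]; [|rewrite Heq; apply Rle_refl].
      left; apply sin_power_integral_lt; lra. }
    rewrite E1, E2 in Hge; nra.
  - intros sigma Hsig eps.
    assert (Hth0 : 0 < acos (- sigma) < PI) by (apply acos_bound_lt; lra).
    assert (Hcos : cos (acos (- sigma)) = - sigma) by (apply cos_acos; lra).
    assert (Hsin : sin (acos (- sigma)) = sqrt (1 - sigma ^ 2)).
    { rewrite sin_acos by lra; f_equal; unfold Rsqr; ring. }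
    assert (Hp := sin_gt_0 _ (proj1 Hth0) (proj2 Hth0)).
    destruct log_sine_primitive_values as [Q0 Q1].
    set (th0 := acos (- sigma)) in *.
    (* first-order coefficient of the defect at [th0] *)
    set (l := (log_sine_primitive (- sigma) - (1 - ln 2)) + (1 + sigma) * (1 - ln 2)).
    assert (H := implicit_angle_expansion (fun s => theta s sigma)
      (fun s => (1 + sigma) * sin_power_integral s (PI / 2)) 1 th0 l
      (32 * th0 + (1 + sigma) * (32 * (PI / 2))) Hth0
      (fun s Hs => Hang s sigma Hs Hsig)).
    assert (Hexp : locally 1 (fun s => 0 < s < 1 ->
      Rabs (sin_power_integral s th0 - (1 + sigma) * sin_power_integral s (PI / 2)
        - l * (s - 1)) <= (32 * th0 + (1 + sigma) * (32 * (PI / 2))) * (s - 1) ^ 2)).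
    { apply filter_imp with (fun s => 1 / 2 < s); [|apply open_gt; lra].
      intros s Hs Hs1.
      assert (A := sin_power_integral_expansion_1 th0 s Hth0 ltac:(lra)).
      assert (B := sin_power_integral_expansion_1 (PI / 2) s ltac:(lra) ltac:(lra)).
      rewrite Hcos, Q1 in A; rewrite cos_PI2, Q0, Q1 in B.
      replace (_ - l * (s - 1)) with
        ((sin_power_integral s th0 - (1 - - sigma)
           - (s - 1) * (log_sine_primitive (- sigma) - (1 - ln 2)))
         + - ((1 + sigma) * (sin_power_integral s (PI / 2) - (1 - 0)
           - (s - 1) * (0 - (1 - ln 2))))) by (unfold l; ring).
      apply Rle_trans with (1 := Rabs_triang _ _).
      rewrite Rabs_Ropp, Rabs_mult, (Rabs_pos_eq (1 + sigma)) by lra.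
      apply (Rmult_le_compat_l (1 + sigma)) in B; lra. }
    specialize (H Hexp eps).
    rewrite Rpower_1 in H by exact Hp; rewrite Hsin in H, Hp.
    unfold at_left, within; generalize (filter_and _ _ H (open_gt 0 1 Rlt_0_1)); apply filter_imp.
    intros s [Hs Hs0] Hs1; specialize (Hs (conj Hs0 Hs1)).
    change (norm ?x) with (Rabs x).
    rewrite (Rabs_minus_sym 1 s).
    replace (_ / (2 * sqrt (1 - sigma ^ 2)) * (1 - s))
      with (l / sqrt (1 - sigma ^ 2) * (s - 1)); [exact Hs|].
    unfold l, log_sine_primitive; replace (1 - - sigma) with (1 + sigma) by ring.
    replace (1 + - sigma) with (1 - sigma) by ring; field; lra.
  - intros sigma Hsig eps.
    set (th0 := PI / 2 * (1 + sigma)).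
    assert (Hth0 : 0 < th0 < PI) by (unfold th0; nra).
    assert (Hsin : sin th0 = cos (PI * sigma / 2)).
    { rewrite cos_sin; f_equal; unfold th0; field. }
    assert (Hp := sin_gt_0 _ (proj1 Hth0) (proj2 Hth0)).
    destruct (sin_power_integral_expansion_0 th0 Hth0) as [C1 HC1].
    destruct (sin_power_integral_expansion_0 (PI / 2) ltac:(lra)) as [C2 HC2].
    rewrite sin_PI2, ln_1 in HC2.
    set (l := th0 * ln (sin th0) - Xi th0 + (1 + sigma) * Xi (PI / 2)).
    assert (H := implicit_angle_expansion (fun s => theta s sigma)
      (fun s => (1 + sigma) * sin_power_integral s (PI / 2)) 0 th0 l
      (C1 + (1 + sigma) * C2) Hth0
      (fun s Hs => Hang s sigma Hs Hsig)).
    assert (Hexp : locally 0 (fun s => 0 < s < 1 ->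
      Rabs (sin_power_integral s th0 - (1 + sigma) * sin_power_integral s (PI / 2)
        - l * (s - 0)) <= (C1 + (1 + sigma) * C2) * (s - 0) ^ 2)).
    { apply filter_forall; intros s Hs.
      specialize (HC1 s ltac:(lra)); specialize (HC2 s ltac:(lra)).
      rewrite Rminus_0_r.
      replace (_ - l * s) with
        ((sin_power_integral s th0 - th0 - s * (th0 * ln (sin th0) - Xi th0))
         + - ((1 + sigma) * (sin_power_integral s (PI / 2) - PI / 2
           - s * (PI / 2 * 0 - Xi (PI / 2))))) by (unfold l, th0; ring).
      apply Rle_trans with (1 := Rabs_triang _ _).
      rewrite Rabs_Ropp, Rabs_mult, (Rabs_pos_eq (1 + sigma)) by lra.
      apply (Rmult_le_compat_l (1 + sigma)) in HC2; lra. }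
    specialize (H Hexp eps).
    rewrite Rpower_O in H by exact Hp.
    unfold at_right, within; generalize (filter_and _ _ H (open_lt 1 0 Rlt_0_1)); apply filter_imp.
    intros s [Hs Hs1] Hs0; specialize (Hs (conj Hs0 Hs1)).
    change (norm ?x) with (Rabs x).
    rewrite Rdiv_1_r, !Rminus_0_r in Hs; unfold l in Hs; rewrite Hsin in Hs.
    exact Hs.
Qed.
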